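(* For every integer $n\ge0$, every $i\in\{0,2\}$ and every $j\in\{0,1,2,3,4\}$, the number of partitions $\pi$ of $5n+4$ with $\mathrm{srank}(\pi)\equiv i\pmod4$ and $c_5(\pi)\equiv j\pmod 5$ equals $\tfrac15 p_i(5n+4)$.
   Context: For a partition $\pi$, $\pi'$ is its conjugate, $\mathcal O(\pi)$ the number of odd parts, $\mathrm{srank}(\pi)=\mathcal O(\pi)-\mathcal O(\pi')$, and $p_i(n)$ ($i=0,2$) the number of partitions of $n$ with $\mathrm{srank}\equiv i\pmod4$. A $t$-core is a partition with no rim hook (border strip) of length $t$; the $t$-core of $\pi$ is the $t$-core obtained by successively removing rim hooks of length $t$ from $\pi$ as long as possible. In the Young diagram, the cell in row $a$ and column $b$ is labelled by the residue of $b-a$ modulo $t$. For a $t$-core $\kappa$, let $r_i$ ($0\le i\le t-1$) be the number of cells of $\kappa$ labelled $i$; its $n$-vector is $(n_0,\dots,n_{t-1})=(r_0-r_1,r_1-r_2,\dots,r_{t-2}-r_{t-1},r_{t-1}-r_0)$. 5-core crank: for a partition $\pi$ with $|\pi|\equiv4\pmod5$, let $(n_0,\dots,n_4)$ be the $n$-vector of the 5-core of $\pi$; then $c_5(\pi)$ is defined modulo $5$ by $c_5(\pi)\equiv 2(1+n_0-n_1-n_2+n_3)\pmod 5$. *)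

(* Defs.v *)
From mathcomp Require Import all_boot all_order all_algebra.
From mathcomp Require Import boolp.
Set Implicit Arguments. Unset Strict Implicit. Unset Printing Implicit Defensive.
Import GRing.Theory Num.Theory.

Definition is_partition (s : seq nat) : bool :=
  sorted geq s && all (fun x => 0 < x) s.

Definition conj_part (s : seq nat) : seq nat :=
  [seq count (fun x => k <= x) s | k <- iota 1 (head 0 s)].

Definition nodd (s : seq nat) : nat := count odd s.

Definition srank (s : seq nat) : int := (Posz (nodd s) - Posz (nodd (conj_part s)))%R.

(* Young diagram cells, 0-indexed: (r, c) with c < s_r.  The cell in row a
   and column b (1-indexed) is (a-1, b-1); its label b - a is c - r. *)

Definition skew (lam mu : seq nat) (x : nat * nat) : bool :=
  (nth 0 mu x.1 <= x.2) && (x.2 < nth 0 lam x.1).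

Definition adj (x y : nat * nat) : bool :=
  ((x.1 == y.1) && ((x.2 == y.2.+1) || (y.2 == x.2.+1))) ||
  ((x.2 == y.2) && ((x.1 == y.1.+1) || (y.1 == x.1.+1))).

Definition rim_hook_removal (t : nat) (lam mu : seq nat) : Prop :=
  [/\ is_partition mu,
      (forall r, nth 0 mu r <= nth 0 lam r),
      sumn lam = sumn mu + t,
      (forall r c, ~ [/\ skew lam mu (r, c), skew lam mu (r, c.+1),
                         skew lam mu (r.+1, c) & skew lam mu (r.+1, c.+1)]) &
      (forall x y, skew lam mu x -> skew lam mu y ->
         exists p : seq (nat * nat),
           [/\ path adj x p, last x p = y & all (skew lam mu) p])].

Inductive removes_to (t : nat) : seq nat -> seq nat -> Prop :=
  | removes_refl lam : removes_to t lam lam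
  | removes_step lam mu nu :
      rim_hook_removal t lam mu -> removes_to t mu nu -> removes_to t lam nu.

Definition is_core (t : nat) (k : seq nat) : Prop :=
  ~ exists mu, rim_hook_removal t k mu.

Definition core_of (t : nat) (lam k : seq nat) : Prop :=
  removes_to t lam k /\ is_core t k.

Definition rcount (t : nat) (k : seq nat) (i : nat) : int :=
  Posz (\sum_(r < size k) \sum_(c < nth 0 k r)
     nat_of_bool ((((Posz c) - (Posz r))%R %% (Posz t))%Z == (Posz i))).

Definition nvec (t : nat) (k : seq nat) (i : nat) : int :=
  (rcount t k i - rcount t k ((i.+1) %% t))%R.

Definition c5_cong (s : seq nat) (j : nat) : Prop :=
  exists k, core_of 5 s k /\
    ((2 * (1 + nvec 5 k 0 - nvec 5 k 1 - nvec 5 k 2 + nvec 5 k 3))%R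
       = (Posz j) %[mod (Posz 5)])%Z.

Definition srank_cong (s : seq nat) (i : nat) : bool :=
  (srank s == (Posz i) %[mod (Posz 4)])%Z.

(* Encoding of partitions of m: m-tuples of integers in [0, m], nonincreasing,
   summing to m; the partition is the list of the nonzero entries.
   This is a bijection onto the partitions of m. *)
Definition ptuple (m : nat) := (m.-tuple 'I_m.+1)%type.

Definition valid (m : nat) (t : ptuple m) : bool :=
  sorted geq (map val t) && (sumn (map val t) == m).

Definition parts_of (m : nat) (t : ptuple m) : seq nat :=
  [seq x <- map val t | 0 < x].

Definition p_srank (i m : nat) : nat :=
  #|[set t : ptuple m | valid t && srank_cong (parts_of t) i]|.

Definition p_srank_c5 (i j m : nat) : nat :=
  #|[set t : ptuple m | valid t &&
       `[< srank_cong (parts_of t) i /\ c5_cong (parts_of t) j >]]|.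

(* Main.v *)
Require Import Defs.
From mathcomp Require Import all_boot all_order all_algebra.
From mathcomp Require Import boolp.
From mathcomp Require Import zify.

(** Encode a partition [s], padded to [M = 10 L] rows, by its beads
    [s_r + (M - 1 - r)].  Up to constants, [|s|] is the sum of the beads, the entry
    [n_i] of the n-vector is the number of beads congruent to [i] modulo 5, and
    [srank s] modulo 4 is [|s|] minus the number of even beads.  As a rim hook of
    length 5 has one cell of each residue, the n-vector of the 5-core is that of
    the partition itself, so the 5-core crank needs no core.

    The n-vectors of partitions of [5n+4] are parametrized by integers
    [alpha_0, ..., alpha_4] of sum 1 in such a way that the size of the core is
    invariant under cyclic rotation of the [alpha_i], while the crank is
    [sum_i (i+1) alpha_i] modulo 5 and grows by 1.  The rotation is realized on beads by
    moving each residue class modulo 5 rigidly onto another one.  All the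
    displacements turn out to be even, so the number of even beads, hence [srank]
    modulo 4, is unchanged.  This gives injections from each crank class to the
    next, cyclically, so the five classes are equinumerous. *)

Set Implicit Arguments. Unset Strict Implicit. Unset Printing Implicit Defensive.
Import GRing.Theory.

(** * Residue counts as sums over padded rows *)

Lemma geq_trans : transitive geq.
Proof. by move=> a b c /= ab ca; exact: leq_trans ca ab. Qed.

Lemma sumn_nth N s : size s <= N -> sumn s = \sum_(0 <= r < N) nth 0 s r.
Proof.
move=> hs; rewrite sumnE (big_nth 0) [RHS](big_cat_nat (leq0n _) hs) /= [X in _ + X]big1_seq.
  by rewrite addn0.
by move=> r /=; rewrite mem_index_iota => /andP[h _]; rewrite nth_default.
Qed.

Lemma modz_content t q r c : r <= q * t ->
  ((Posz c - Posz r)%R %% Posz t)%Z = Posz ((c + (q * t - r)) %% t).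
Proof.
move=> ler.
rewrite -modz_nat -(modzMDl (Posz q) (Posz c - Posz r)%R).
by congr (_ %% _)%Z; lia.
Qed.

Lemma rcountE t q k i : size k <= q * t ->
  rcount t k i = Posz (\sum_(0 <= r < q * t) \sum_(0 <= c < nth 0 k r)
     nat_of_bool ((c + (q * t - r)) %% t == i)).
Proof.
move=> lek; rewrite /rcount; congr Posz.
rewrite (big_cat_nat (leq0n (size k)) lek) /= [X in _ = _ + X]big1_seq.
  rewrite addn0 big_mkord; apply: eq_bigr => r _; rewrite big_mkord.
  apply: eq_bigr => c _; rewrite (@modz_content t q); first by [].
  exact: leq_trans (ltnW (ltn_ord r)) lek.
by move=> r /=; rewrite mem_index_iota => /andP[hr _]; rewrite nth_default ?big_geq.
Qed.

(** * Contents of the cells of a rim hook *)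

Definition cells (N : nat) (lam mu : seq nat) : seq (nat * nat) :=
  [seq (r, c) | r <- index_iota 0 N, c <- index_iota (nth 0 mu r) (nth 0 lam r)].

Lemma skew_row_lt N lam mu z : size lam <= N -> Defs.skew lam mu z -> z.1 < N.
Proof.
move=> lN /andP[_ h]; apply: leq_trans lN; rewrite ltnNge; apply/negP=> h'.
by rewrite (nth_default 0 h') in h.
Qed.

Lemma mem_cells N lam mu x : size lam <= N -> (x \in cells N lam mu) = Defs.skew lam mu x.
Proof.
case: x => r c leN; rewrite /Defs.skew /=; apply/allpairsPdep/idP.
  by case=> r' [c' [_ hc [-> ->]]]; move: hc; rewrite mem_index_iota.
move=> hs; exists r, c; split; rewrite ?mem_index_iota //=.
by rewrite ltnNge; apply/negP=> h; move: hs; rewrite (nth_default 0 (leq_trans leN h)) andbF.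
Qed.

Lemma cells_uniq N lam mu : uniq (cells N lam mu).
Proof.
apply: allpairs_uniq_dep; rewrite ?iota_uniq //.
- by move=> r _; rewrite iota_uniq.
- by move=> [r c] [r' c'] _ _ /= [-> ->].
Qed.

Lemma big_cells N lam mu (F : nat -> nat -> nat) :
  \sum_(x <- cells N lam mu) F x.1 x.2 =
  \sum_(0 <= r < N) \sum_(nth 0 mu r <= c < nth 0 lam r) F r c.
Proof. by rewrite /cells big_allpairs_dep. Qed.

(* Shifted by [N] so as to stay in nat *)
Definition content (N : nat) (x : nat * nat) : nat := x.2 + (N - x.1).

(** Adjacent cells have contents differing by 1, so a path takes every intermediate value. *)
Lemma path_content_ivt N (S : pred (nat * nat)) x p z :
  (forall y, S y -> y.1 < N) -> S x -> path adj x p -> all S p ->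
  minn (content N x) (content N (last x p)) <= z ->
  z <= maxn (content N x) (content N (last x p)) ->
  exists2 y, S y & content N y = z.
Proof.
move=> SN; elim: p x => [|y p IH] x Sx /=.
  by move=> _ _ h1 h2; exists x => //; lia.
case/andP=> hxy hp /andP[Sy Sp] h1 h2.
have hc : content N y <= (content N x).+1 /\ content N x <= (content N y).+1.
  move: hxy (SN _ Sx) (SN _ Sy); rewrite /adj /content.
  by case: x {Sx h1 h2} => a b; case: y {hp Sy} => a' b' /=; lia.
have [<-|ne] := eqVneq (content N x) z; first by exists x.
by apply: (IH y) => //; lia.
Qed.

Lemma is_partition_nth s r r' : is_partition s -> r <= r' -> nth 0 s r' <= nth 0 s r.
Proof.
case/andP=> ss _ lerr.
have [h|h] := ltnP r' (size s); last by rewrite nth_default.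
have rf : reflexive geq by move=> a /=.
by apply: (sorted_leq_nth geq_trans rf 0 ss) => //; rewrite inE ?(leq_ltn_trans lerr).
Qed.

(** Two distinct cells on one diagonal would enclose a 2 by 2 block of the skew shape, starting at
    the upper cell. *)
Lemma rim_hook_content_inj t N lam mu x y :
  is_partition lam -> rim_hook_removal t lam mu -> size lam <= N ->
  Defs.skew lam mu x -> Defs.skew lam mu y -> content N x = content N y -> x = y.
Proof.
move=> pl [pm _ _ n22 _] leN.
have SN z : Defs.skew lam mu z -> z.1 < N by exact: skew_row_lt.
wlog: x y / x.1 <= y.1.
  move=> hw hx hy e; case: (leqP x.1 y.1) => h; first exact: hw.
  by apply/esym/hw => //; exact: ltnW.
case: x => r c; case: y => r' c' /= ler hx hy.
move: (SN _ hx) (SN _ hy) => /= rN r'N; rewrite /content /= => e.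
have [eqr|ner] := eqVneq r r'; first by subst; congr pair; lia.
exfalso; apply: (n22 r c); rewrite /Defs.skew /=.
move: hx hy; rewrite /Defs.skew /= => /andP[h1 h2] /andP[h3 h4].
have rr' : r.+1 <= r' by lia.
have l1 := is_partition_nth pl rr'; have l2 := is_partition_nth pl (leqnSn r).
by have := is_partition_nth pm (ltnW rr'); have := is_partition_nth pm (leqnSn r); split; lia.
Qed.

Lemma interval_perm_iota (K : seq nat) (x0 : nat) : x0 \in K -> uniq K ->
  (forall x y z, x \in K -> y \in K -> x <= z <= y -> z \in K) ->
  exists a, perm_eq K (iota a (size K)).
Proof.
move=> x0K uK cK.
have exK : exists x, x \in K by exists x0.
have bK x : x \in K -> x <= \max_(y <- K) y by move=> xK; exact: leq_bigmax_seq.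
pose a := ex_minn exK; pose b := ex_maxn exK bK; exists a.
have [aK amin] : a \in K /\ forall x, x \in K -> a <= x by rewrite /a; case: ex_minnP.
have [bK' bmax] : b \in K /\ forall x, x \in K -> x <= b by rewrite /b; case: ex_maxnP.
have pK : perm_eq K (iota a (b.+1 - a)).
  apply: uniq_perm; rewrite ?iota_uniq // => x; rewrite mem_iota.
  apply/idP/idP=> [xK|h]; first by have := amin _ xK; have := bmax _ xK; lia.
  by apply: (cK a b) => //; have := bmax _ aK; lia.
by rewrite (perm_size pK) size_iota.
Qed.

(** Sliding the window by one trades [a] for [a + t], which has the same residue. *)
Lemma count_residue_iota a t i : i < t ->
  \sum_(x <- iota a t) nat_of_bool (x %% t == i) = 1.
Proof.
move=> lt; have t0 : 0 < t by case: t lt.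
elim: a => [|a IH].
  rewrite -{1}[t]subn0 -/(index_iota 0 t) big_mkord.
  rewrite (bigD1 (Ordinal lt)) //= modn_small // eqxx big1 // => k ne.
  by rewrite modn_small //; apply/eqP; rewrite eqb0; apply: contra ne => /eqP e; apply/eqP/val_inj.
move: IH; case: t t0 lt => [|t] // _ lt; rewrite -[iota a t.+1]/(a :: iota a.+1 t) big_cons.
move=> <-; rewrite -[X in iota a.+1 X]addn1 iotaD big_cat big_seq1 [LHS]addnC.
by rewrite addSnnS modnDr.
Qed.

(** The contents of the [t] removed cells are distinct and, by connectedness, fill an interval, so
    each residue occurs once. *)
Lemma rim_hook_rcount t lam mu i : i < t ->
  is_partition lam -> rim_hook_removal t lam mu ->
  (rcount t lam i = rcount t mu i + 1)%R.
Proof.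
move=> lt pl hrim; have [pm sub sz _ conn] := hrim.
set q := size lam + size mu; have t0 : 0 < t by case: t lt {hrim sz}.
have lq s : s <= q -> s <= q * t by move=> h; apply: leq_trans h (leq_pmulr _ t0).
have lN : size lam <= q * t by apply: lq; rewrite leq_addr.
have mN : size mu <= q * t by apply: lq; rewrite leq_addl.
set N := q * t in lN mN.
pose X := cells N lam mu; pose K := map (content N) X.
have memX x : (x \in X) = Defs.skew lam mu x by exact: mem_cells.
have SN z : Defs.skew lam mu z -> z.1 < N by exact: skew_row_lt.
have split_rows (F : nat -> nat -> nat) :
    \sum_(0 <= r < N) \sum_(0 <= c < nth 0 lam r) F r c =
    \sum_(0 <= r < N) \sum_(0 <= c < nth 0 mu r) F r c + \sum_(x <- X) F x.1 x.2.
  rewrite big_cells -big_split /=; apply: eq_bigr => r _.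
  by rewrite (big_cat_nat (leq0n _) (sub r)).
have sumE s : size s <= N -> sumn s = \sum_(0 <= r < N) \sum_(0 <= c < nth 0 s r) 1.
  move=> hs; rewrite (sumn_nth hs); apply: eq_bigr => r _.
  by rewrite sum_nat_const_nat muln1 subn0.
have sX : size X = t.
  by move: (split_rows (fun _ _ => 1)); rewrite -!sumE // sum1_size sz => /addnI.
have uK : uniq K.
  rewrite map_inj_in_uniq ?cells_uniq // => x y; rewrite !memX => hx hy.
  exact: rim_hook_content_inj hrim _ hx hy.
have [x0 x0X] : exists x, x \in X.
  by move: sX; case: X {memX K uK split_rows} => [|x s] /= h; [lia | exists x; rewrite mem_head].
have [a pK] : exists a, perm_eq K (iota a (size K)).
  apply: (@interval_perm_iota _ (content N x0)) => //; first exact: map_f.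
  move=> _ _ z /mapP[x xX ->] /mapP[y yX ->] /andP[h1 h2].
  move: xX yX; rewrite !memX => hx hy.
  have [p [pp lp ap]] := conn _ _ hx hy.
  have [||w hw <-] := path_content_ivt (z := z) SN hx pp ap; rewrite ?lp; try lia.
  by apply: map_f; rewrite memX.
rewrite !(@rcountE t q) // (split_rows (fun r c => nat_of_bool ((c + (N - r)) %% t == i))).
suff -> : \sum_(x <- X) nat_of_bool ((x.2 + (N - x.1)) %% t == i) = 1 by rewrite PoszD.
rewrite -(@count_residue_iota a t i lt) -{2}sX -(size_map (content N)) -(perm_big _ pK) /=.
by rewrite big_map.
Qed.

(** * The crank computed without the core *)

Lemma nvec_removes_to t lam mu i : i < t ->
  is_partition lam -> removes_to t lam mu -> nvec t mu i = nvec t lam i.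
Proof.
move=> lt pl h; elim: h pl => [//|{}lam {}mu nu hr _ IH] pl.
have [pm _ _ _ _] := hr; rewrite IH // /nvec.
have t0 : 0 < t by case: t lt {hr IH}.
by rewrite !(rim_hook_rcount _ pl hr) ?ltn_mod //; lia.
Qed.

(** Each removal lowers the size by [t], so removal stops; excluded middle decides whether a hook is
    left. *)
Lemma core_exists t lam : 0 < t -> is_partition lam -> exists k, core_of t lam k.
Proof.
move=> t0; have [m] := ubnP (sumn lam); elim: m lam => [//|m IH] lam lem pl.
have [[mu hr]|nh] := EM (exists mu, rim_hook_removal t lam mu); last first.
  by exists lam; split => //; exact: removes_refl.
have [pm _ sz _ _] := hr; have [|//|k [hk ck]] := IH mu; first by lia.
by exists k; split => //; exact: removes_step hk.
Qed.

Definition crank5 (s : seq nat) : int :=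
  (2 * (1 + nvec 5 s 0 - nvec 5 s 1 - nvec 5 s 2 + nvec 5 s 3))%R.

Lemma c5_congE s j : is_partition s ->
  c5_cong s j <-> (crank5 s = Posz j %[mod Posz 5])%Z.
Proof.
move=> ps; split=> [[k [[hk _] <-]]|h].
  by rewrite /crank5 !(nvec_removes_to _ ps hk).
have [k [hk ck]] := @core_exists 5 s isT ps; exists k; split=> //.
by rewrite !(nvec_removes_to _ ps hk).
Qed.

(** * Partitions and sets of beads *)

Lemma nth_filter_pos s r : sorted geq s -> nth 0 [seq x <- s | 0 < x] r = nth 0 s r.
Proof.
elim: s r => [//|x s IH] r ss; have ss' := path_sorted ss.
rewrite /=; have [x0|x0] := ltnP 0 x; first by case: r => //= r; exact: IH.
have zs : all (pred1 0) s.
  have := order_path_min geq_trans ss; apply: sub_all => y /=; lia.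
rewrite (eq_in_filter (a2 := pred0)) ?filter_pred0.
  rewrite nth_nil; case: r => [|r] /=; first by lia.
  by case: (ltnP r (size s)) => h; [rewrite (eqP (all_nthP 0 zs r h)) | rewrite nth_default].
by move=> y /(allP zs) /eqP ->.
Qed.

Lemma filter_pos_is_partition s : sorted geq s -> is_partition [seq x <- s | 0 < x].
Proof.
move=> ss; rewrite /is_partition filter_all andbT.
exact: sorted_filter geq_trans _ _ ss.
Qed.

Lemma partition_eq_nth s s' : is_partition s -> is_partition s' ->
  (forall r, nth 0 s r = nth 0 s' r) -> s = s'.
Proof.
have le u v : is_partition u -> (forall r, nth 0 u r = nth 0 v r) -> size u <= size v.
  move=> /andP[_ /all_nthP h] e; rewrite leqNgt; apply/negP => lt.
  by have := h 0 _ lt; rewrite e nth_default.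
move=> ps ps' e; apply: (@eq_from_nth _ 0) => [|r _]; last exact: e.
by apply/eqP; rewrite eqn_leq !le.
Qed.

Definition beads (M : nat) (s : seq nat) : seq nat :=
  [seq nth 0 s r + (M - r.+1) | r <- index_iota 0 M].

(** Inverse of [beads] for duplicate-free [B], up to order: a bead yields the number of gaps below
    it, and empty rows are dropped. *)
Definition of_beads (B : seq nat) : seq nat :=
  [seq x <- [seq nth 0 (sort geq B) r - (size B - r.+1) | r <- index_iota 0 (size B)] | 0 < x].

Lemma size_beads M s : size (beads M s) = M.
Proof. by rewrite size_map size_iota subn0. Qed.

Lemma nth_beads M s r : r < M -> nth 0 (beads M s) r = nth 0 s r + (M - r.+1).
Proof. by move=> h; rewrite (nth_map 0) ?size_iota ?subn0 // nth_iota ?subn0. Qed.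

Lemma sorted_beads M s : is_partition s -> sorted gtn (beads M s).
Proof.
move=> ps; apply/(sortedP 0) => r; rewrite size_beads => lt.
by rewrite !nth_beads //=; [have := is_partition_nth ps (leqnSn r); lia | lia].
Qed.

Lemma gtn_sorted_uniq B : sorted gtn B = uniq B && sorted geq B.
Proof.
by rewrite -[sorted gtn B]rev_sorted -[sorted geq B]rev_sorted ltn_sorted_uniq_leq rev_uniq.
Qed.

Lemma uniq_beads M s : is_partition s -> uniq (beads M s).
Proof. by move=> /(sorted_beads M); rewrite gtn_sorted_uniq => /andP[]. Qed.

Lemma beads_inj M s s' : is_partition s -> is_partition s' ->
  size s <= M -> size s' <= M -> perm_eq (beads M s) (beads M s') -> s = s'.
Proof.
move=> ps ps' sM sM' pe; apply: partition_eq_nth => // r.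
have [rM|Mr] := ltnP r M; last by rewrite !nth_default //; lia.
have e : beads M s = beads M s'.
  apply: (sorted_eq geq_trans) pe; first by move=> a b /=; lia.
  - by have := sorted_beads M ps; rewrite gtn_sorted_uniq => /andP[].
  - by have := sorted_beads M ps'; rewrite gtn_sorted_uniq => /andP[].
by have := congr1 (nth 0 ^~ r) e; rewrite /= !nth_beads //; lia.
Qed.

Section OfBeads.
Variable B : seq nat.
Hypothesis uB : uniq B.
Let M := size B.
Let S := sort geq B.

Let sortedS : sorted gtn S.
Proof.
rewrite gtn_sorted_uniq sort_uniq uB /=; apply: sort_sorted => a b /=; lia.
Qed.

Let nthS r d : r + d < M -> nth 0 S (r + d) + d <= nth 0 S r.
Proof.
elim: d => [|d IH] lt; first by rewrite !addn0.
have {}IH := IH ltac:(lia).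
have /sortedP := sortedS; move=> /(_ 0 (r + d)); rewrite size_sort -/M -addnS => /(_ lt) /=.
lia.
Qed.

Let nth_row r : r < M ->
  nth 0 [seq nth 0 S r - (M - r.+1) | r <- index_iota 0 M] r = nth 0 S r - (M - r.+1).
Proof. by move=> h; rewrite (nth_map 0) ?size_iota ?subn0 // nth_iota ?subn0. Qed.

Let sorted_rows : sorted geq [seq nth 0 S r - (M - r.+1) | r <- index_iota 0 M].
Proof.
apply/(sortedP 0) => r; rewrite size_map size_iota subn0 => lt.
by rewrite /= !nth_row; [have := @nthS r 1; rewrite addn1; lia | lia | lia].
Qed.

Lemma of_beads_is_partition : is_partition (of_beads B).
Proof. exact: filter_pos_is_partition. Qed.

Lemma size_of_beads : size (of_beads B) <= size B.
Proof. by rewrite size_filter (leq_trans (count_size _ _)) // size_map size_iota subn0. Qed.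

Lemma of_beadsK : perm_eq (beads (size B) (of_beads B)) B.
Proof.
rewrite perm_sym -(perm_sort geq B) perm_sym.
suff -> : beads M (of_beads B) = S by rewrite perm_refl.
apply: (@eq_from_nth _ 0) => [|r]; rewrite size_beads ?size_sort // => lt.
rewrite nth_beads // nth_filter_pos // nth_row // subnK //.
(* Comparison with the smallest bead gives [M - r.+1 <= nth 0 S r], so the subtraction is not
   truncated. *)
by have := @nthS r (M - r.+1); lia.
Qed.
End OfBeads.

(** * Size, n-vector and srank read off the beads *)

Lemma big_beads (R : Type) (idx : R) (op : Monoid.law idx) M s (F : nat -> R) :
  \big[op/idx]_(b <- beads M s) F b =
  \big[op/idx]_(0 <= r < M) F (nth 0 s r + (M - r.+1)).
Proof. by rewrite big_map. Qed.

Lemma sum_beads M s : size s <= M ->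
  2 * \sum_(b <- beads M s) b + M = 2 * sumn s + M * M.
Proof.
move=> sM; rewrite big_beads big_split /= -sumn_nth //.
suff : 2 * (\sum_(0 <= r < M) (M - r.+1)) + M = M * M by lia.
elim: M {sM} => [|M IH]; first by rewrite big_geq.
by rewrite big_nat_recl // subSS subn0 (eq_bigr (fun r => M - r.+1)) //; lia.
Qed.

Lemma count_sum (T : Type) (P : pred T) (s : seq T) : count P s = \sum_(x <- s) P x.
Proof. by rewrite -sum1_count big_mkcond. Qed.

(* Along a row the residues [i] and [i+1] alternate, so only the two ends contribute. *)
Lemma row_residues t i a l : 0 < t -> i < t ->
  \sum_(0 <= c < l) ((c + a.+1) %% t == i) + (a %% t == i) =
  \sum_(0 <= c < l) ((c + a.+1) %% t == i.+1 %% t) + ((l + a) %% t == i).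
Proof.
move=> t0 it; elim: l => [|l IH]; first by rewrite !big_geq.
rewrite !big_nat_recr //=.
have -> : ((l + a.+1) %% t == i.+1 %% t) = ((l + a) %% t == i).
  by rewrite addnS -addn1 -[i.+1]addn1 eqn_modDr (modn_small it).
rewrite [l.+1 + a]addSnnS; lia.
Qed.

(** By [row_residues] each row contributes the difference of its two ends. The right ends are the
    beads of [s]; the left ends are those of the empty partition, [0] to [q * t - 1], with [q] in
    each class. *)
Lemma nvec_beads t q s i : i < t -> size s <= q * t ->
  (nvec t s i + Posz q)%R = Posz (count (fun b => b %% t == i) (beads (q * t) s)).
Proof.
move=> it sM; have t0 : 0 < t by case: t it {sM}.
rewrite /nvec !(rcountE _ sM) count_sum big_beads.
set N := q * t.
have rows : \sum_(0 <= r < N) \sum_(0 <= c < nth 0 s r) ((c + (N - r)) %% t == i)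
   + \sum_(0 <= r < N) ((N - r.+1) %% t == i) =
  \sum_(0 <= r < N) \sum_(0 <= c < nth 0 s r) ((c + (N - r)) %% t == i.+1 %% t)
   + \sum_(0 <= r < N) ((nth 0 s r + (N - r.+1)) %% t == i).
  rewrite -!big_split /=; apply: eq_big_nat => r /andP[_ rN].
  have -> : N - r = (N - r.+1).+1 by lia.
  exact: row_residues.
have qE : \sum_(0 <= r < N) ((N - r.+1) %% t == i) = q.
  rewrite (@big_nat_rev _ _ _ 0 N) /= add0n.
  rewrite (eq_big_nat _ _ (F2 := fun r => nat_of_bool (r %% t == i))); last first.
    by move=> r /andP[_ h]; congr (nat_of_bool (_ %% _ == _)); lia.
  rewrite /N; elim: (q) => [|p IH]; first by rewrite big_geq.
  rewrite mulSnr (big_cat_nat (n := p * t)) ?leq_addr //= IH.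
  rewrite /index_iota addKn count_residue_iota //; lia.
by move=> /=; lia.
Qed.

(** A new first row of length [x] flips the parity of the first [x] columns, and all others are
    empty; the number of odd columns becomes [x] minus the old one. *)
Lemma nodd_conj_part_sum s H : sorted geq s -> head 0 s <= H ->
  Posz (\sum_(0 <= k < H) odd (count (fun x => k < x) s)) =
  (\sum_(0 <= r < size s) (-1) ^+ r * Posz (nth 0%N s r))%R.
Proof.
elim: s H => [|x s IH] H ss /= xH; first by rewrite big1 // big_geq.
have hs : head 0 s <= x by case: s ss {IH} => [|y s] //= /andP[].
have sx : {in s, forall y, y <= x}.
  by move=> y ys; have := order_path_min geq_trans ss => /allP /(_ y ys).
rewrite big_nat_recl // expr0 mul1r /=.
under [X in (_ + X)%R]eq_bigr => r _ do rewrite exprS mulN1r mulNr.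
rewrite sumrN -(IH x) ?(path_sorted ss) //.
rewrite (big_cat_nat (n := x)) //= [X in _ + X]big1_seq => [|k]; last first.
  rewrite mem_index_iota => /andP[_ /andP[xk _]].
  rewrite ltnNge xk /= (eq_in_count (a2 := pred0)) ?count_pred0 // => y /sx /=; lia.
suff : \sum_(0 <= k < x) odd ((k < x) + count (fun y => k < y) s) +
       \sum_(0 <= k < x) odd (count (fun y => k < y) s) = x by lia.
rewrite -big_split /= -[RHS]subn0 -[RHS]muln1 -sum_nat_const_nat.
by apply: eq_big_nat => k /andP[_ ->]; rewrite add1n /=; case: odd.
Qed.

Lemma nodd_conj_part s M : is_partition s -> size s <= M ->
  Posz (nodd (conj_part s)) = (\sum_(0 <= r < M) (-1) ^+ r * Posz (nth 0%N s r))%R.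
Proof.
move=> /andP[ss _] sM; rewrite /nodd /conj_part count_map count_sum.
rewrite [RHS](big_cat_nat (leq0n _) sM) /= [X in (_ + X)%R]big1_seq => [|r]; last first.
  by move=> /=; rewrite mem_index_iota => /andP[h _]; rewrite nth_default ?mulr0.
rewrite addr0 -(nodd_conj_part_sum ss (leqnn _)) /index_iota subn0.
by rewrite -[1]/(1 + 0) iotaDl big_map.
Qed.

(* Row [r] of length [l] contributes [odd l - (-1)^r l - l] to [srank s - |s|]
   and [~~ odd (l + r.+1)] to the count of even beads; with the vacuum
   correction [odd r] these cancel modulo 4. *)
Lemma srank_beads s h : is_partition s -> size s <= h.*2 ->
  (srank s + Posz (count (fun b => ~~ odd b) (beads h.*2 s)) =
   Posz (sumn s + h) %[mod 4])%Z.
Proof.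
move=> ps sM; rewrite /srank (nodd_conj_part ps sM) (sumn_nth sM).
have -> : nodd s = \sum_(0 <= r < h.*2) odd (nth 0 s r).
  rewrite /nodd count_sum (big_nth 0) [RHS](big_cat_nat (leq0n _) sM) /=.
  rewrite [X in _ = _ + X]big1_seq ?addn0 // => r.
  by move=> /=; rewrite mem_index_iota => /andP[le _]; rewrite nth_default.
have hE : \sum_(0 <= r < h.*2) odd r = h.
  elim: (h) => [|k IH]; first by rewrite big_geq.
  by rewrite doubleS !big_nat_recr //= IH odd_double /=; lia.
rewrite count_sum big_beads.
pose alt n : int := (\sum_(0 <= r < n) (-1) ^+ r * Posz (nth 0%N s r))%R.
suff H n : n <= h.*2 -> exists k : int,
   (Posz (\sum_(0 <= r < n) odd (nth 0 s r)) - alt n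
    + Posz (\sum_(0 <= r < n) ~~ odd (nth 0 s r + (h.*2 - r.+1)))
    = Posz (\sum_(0 <= r < n) nth 0 s r + \sum_(0 <= r < n) odd r) + k * 4)%R.
  have [k] := H _ (leqnn _); rewrite hE /= => e.
  by rewrite -(modzMDl k (Posz (_ + h)%N)) [(k * 4 + _)%R]addrC; congr (_ %% _)%Z; exact: e.
elim: n => [|n IH] lt; first by exists 0%R; rewrite /alt !big_geq.
have [k e] := IH (ltnW lt); rewrite !big_nat_recr //=.
have -> : alt n.+1 = (alt n + (if odd n then - Posz (nth 0%N s n) else Posz (nth 0%N s n)))%R.
  rewrite /alt big_nat_recr //= -signr_odd.
  by case: odd; rewrite ?expr0 ?expr1 ?mulN1r ?mul1r.
rewrite oddD oddB // odd_double /=.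
(* For odd [n] the contributions of the row cancel; for even [n] a row of length [l] leaves
   [2 * odd l - 2 * l], which is [-4 * l./2]. *)
exists (k - (if odd n then 0 else Posz (nth 0%N s n)./2%N))%R.
have := odd_double_half (nth 0 s n); case: (odd n); case: odd => /=; lia.
Qed.

(** * Moving the residue classes modulo 5 *)

(* The entries [n_i + i] have the parities of [alpha_4 + alpha_0],
   [alpha_2 + alpha_3], [alpha_1 + alpha_2], [alpha_0 + alpha_1] and
   [alpha_3 + alpha_4]; [rot5] is how a rotation of the [alpha_i] permutes these
   pairs, which is why each runner can be displaced by an even amount. *)
Definition rot5 (i : nat) : nat := nth 0 [:: 3; 4; 1; 2; 0] i.

Definition move_bead (D : nat -> nat) (b : nat) : nat :=
  (b %/ 5 + D (b %% 5)) * 5 + rot5 (b %% 5).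

(* Raising runner [i] by [D i] vacates its [D i] lowest positions, refilled here. *)
Definition new_beads (D : nat -> nat) : seq nat :=
  [seq k * 5 + rot5 i | i <- iota 0 5, k <- index_iota 0 (D i)].

Definition transport (D : nat -> nat) (B : seq nat) : seq nat :=
  map (move_bead D) B ++ new_beads D.

Lemma rot5_lt i : rot5 i < 5.
Proof. by case: i => [|[|[|[|[|[|i]]]]]]. Qed.

Lemma rot5_inj : {in gtn 5 &, injective rot5}.
Proof.
by move=> [|[|[|[|[|i]]]]] [|[|[|[|[|j]]]]]; rewrite !inE.
Qed.

Lemma move_bead_mod D b : move_bead D b %% 5 = rot5 (b %% 5).
Proof. by rewrite modnMDl modn_small ?rot5_lt. Qed.

Lemma move_bead_div D b : move_bead D b %/ 5 = b %/ 5 + D (b %% 5).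
Proof. by rewrite divnMDl // (divn_small (rot5_lt _)) addn0. Qed.

Lemma move_bead_inj D : injective (move_bead D).
Proof.
move=> b b' e.
have em : b %% 5 = b' %% 5.
  by apply: rot5_inj; rewrite ?inE ?ltn_mod // -!(move_bead_mod D) e.
have := congr1 (divn^~ 5) e; rewrite /= !move_bead_div em => /addIn ed.
by rewrite (divn_eq b 5) (divn_eq b' 5) ed em.
Qed.

(** On runner [rot5 i] the moved beads have quotient by 5 at least [D i], the refilled ones less. *)
Lemma transport_uniq D B : uniq B -> uniq (transport D B).
Proof.
move=> uB; rewrite cat_uniq map_inj_uniq ?uB /=; last exact: move_bead_inj.
apply/andP; split.
  apply/hasPn => _ /allpairsPdep[i [k [+ + ->]]]; rewrite mem_iota mem_index_iota /= => hi hk.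
  apply/mapP => -[b _ e].
  have em : i = b %% 5.
    apply: rot5_inj; rewrite ?inE ?ltn_mod // -(move_bead_mod D) -e modnMDl.
    by rewrite modn_small ?rot5_lt.
  have := congr1 (divn^~ 5) e; rewrite /= move_bead_div divnMDl //.
  by rewrite (divn_small (rot5_lt _)) -em; lia.
apply: allpairs_uniq_dep => // [i _|]; first exact: iota_uniq.
move=> _ _ /allpairsPdep[i [k [+ _ ->]]] /allpairsPdep[i' [k' [+ _ ->]]] /=.
rewrite !mem_iota /= => hi hi' e.
have ei : i = i'.
  apply: rot5_inj => //; have := congr1 (modn^~ 5) e.
  by rewrite /= !modnMDl !modn_small ?rot5_lt.
by move: e; rewrite ei => /addIn /eqP; rewrite eqn_mul2r /= => /eqP ->.
Qed.

Lemma transport_inj D B B' :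
  perm_eq (transport D B) (transport D B') -> perm_eq B B'.
Proof. by rewrite perm_cat2r; apply: perm_map_inj; exact: move_bead_inj. Qed.

Definition class_count (B : seq nat) (i : nat) : nat := count (fun b => b %% 5 == i) B.

Lemma sum_iota5 (F : nat -> nat) :
  \sum_(i <- iota 0 5) F i = F 0 + F 1 + F 2 + F 3 + F 4.
Proof. by rewrite /= !big_cons big_nil; lia. Qed.

Lemma sum_by_class (F : nat -> nat) B :
  \sum_(b <- B) F (b %% 5) = \sum_(i <- iota 0 5) class_count B i * F i.
Proof.
rewrite sum_iota5 /class_count; elim: B => [|b B IH]; first by rewrite big_nil.
rewrite big_cons IH /=; have := ltn_pmod b (isT : 0 < 5).
by case: (b %% 5) => [|[|[|[|[|x]]]]] //= _; lia.
Qed.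

Lemma big_transport (F : nat -> nat) D B :
  \sum_(b <- transport D B) F b =
  \sum_(b <- B) F (move_bead D b) +
  \sum_(i <- iota 0 5) \sum_(0 <= k < D i) F (k * 5 + rot5 i).
Proof. by rewrite big_cat big_map big_allpairs_dep. Qed.

Lemma size_transport D B : size (transport D B) = size B + \sum_(i <- iota 0 5) D i.
Proof.
have e (s : seq nat) : size s = \sum_(b <- s) 1 by rewrite sum1_size.
rewrite !e big_transport; congr (_ + _); apply: eq_bigr => i _.
by rewrite sum_nat_const_nat subn0 muln1.
Qed.

Lemma class_count_transport D B i : i < 5 ->
  class_count (transport D B) (rot5 i) = class_count B i + D i.
Proof.
move=> i5; rewrite /class_count !count_sum big_transport; congr (_ + _).
  apply: eq_bigr => b _; rewrite move_bead_mod.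
  by rewrite (inj_in_eq rot5_inj) // inE ltn_mod.
rewrite (eq_big_seq (fun j => (j == i) * D j)) => [|j]; last first.
  rewrite mem_iota /= => j5.
  under eq_bigr => k _.
    rewrite modnMDl modn_small ?rot5_lt // (inj_in_eq rot5_inj) //; over.
  by rewrite sum_nat_const_nat subn0 mulnC.
by rewrite sum_iota5; case: i i5 => [|[|[|[|[|i]]]]] //= _; lia.
Qed.

Lemma sum_evens D j : \sum_(0 <= k < D) ~~ odd (k * 5 + j) =
  if odd j then D./2 else uphalf D.
Proof.
elim: D => [|D IH]; first by rewrite big_geq // if_same.
rewrite big_nat_recr //= IH oddD oddM andbT.
by have := odd_double_half D; have := uphalf_half D; case: odd; case: odd => /=; lia.
Qed.

(* The parity condition makes [move_bead D] preserve the parity of every bead. *)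
Lemma even_count_transport D B : (forall i, i < 5 -> odd (D i) = odd (rot5 i + i)) ->
  2 * count (fun b => ~~ odd b) (transport D B) =
  2 * count (fun b => ~~ odd b) B + \sum_(i <- iota 0 5) D i.
Proof.
move=> pD; rewrite !count_sum big_transport mulnDr; congr (_ + _).
  congr (2 * _); apply: eq_bigr => b _; have b5 := ltn_pmod b (isT : 0 < 5).
  rewrite {2}(divn_eq b 5) /move_bead !oddD !oddM !oddD pD // !andbT oddD.
  by case: (odd (b %/ 5)); case: (odd (rot5 _)); case: (odd (b %% 5)).
(* Among the refilled beads, half of [D 0] and of [D 2] is rounded down, half of [D 1] and of [D 3]
   is rounded up, and [D 4] is even, so the rounding errors cancel. *)
rewrite !sum_iota5 !sum_evens /=.
move: (pD 0 isT) (pD 1 isT) (pD 2 isT) (pD 3 isT) (pD 4 isT) => /= p0 p1 p2 p3 p4.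
by move: (uphalf_half (D 2)) (uphalf_half (D 3)) (uphalf_half (D 4))
  (uphalf_half (D 0)) (uphalf_half (D 1))
  (odd_double_half (D 0)) (odd_double_half (D 1)) (odd_double_half (D 2))
  (odd_double_half (D 3)) (odd_double_half (D 4)); rewrite p0 p1 p2 p3 p4 /=; lia.
Qed.

(** A bead of class [i] gains [5 * D i + rot5 i - i], and the refill adds
    [5 * D i * (D i - 1) / 2 + rot5 i * D i]. Doubling and moving negative terms across keeps this
    in [nat]. *)
Lemma sum_transport D B :
  2 * \sum_(b <- transport D B) b
    + \sum_(i <- iota 0 5) (2 * (class_count B i * i) + 5 * D i) =
  2 * \sum_(b <- B) b
    + \sum_(i <- iota 0 5) (2 * (class_count B i * (5 * D i + rot5 i))
                            + (5 * D i * D i + 2 * (rot5 i * D i))).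
Proof.
have moved : \sum_(b <- B) move_bead D b + \sum_(i <- iota 0 5) class_count B i * i =
  \sum_(b <- B) b + \sum_(i <- iota 0 5) class_count B i * (5 * D i + rot5 i).
  rewrite -!(sum_by_class id) -(sum_by_class (fun i => 5 * D i + rot5 i)) -!big_split /=.
  by apply: eq_bigr => b _; rewrite {3}(divn_eq b 5) /move_bead; lia.
have new d j : 2 * (\sum_(0 <= k < d) (k * 5 + j)) + 5 * d = 5 * d * d + 2 * (j * d).
  by elim: d => [|d IH]; [rewrite big_geq; lia | rewrite big_nat_recr //=; nia].
rewrite big_transport; move: moved; rewrite !sum_iota5.
have := new (D 0) (rot5 0); have := new (D 1) (rot5 1); have := new (D 2) (rot5 2).
have := new (D 3) (rot5 3); have := new (D 4) (rot5 4); lia.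
Qed.

(** * Rotation of the alpha coordinates *)

(* The coordinate [alpha_4] of Garvan, Kim and Stanton: [n_0 = alpha_0 + alpha_4],
   [n_1 = - alpha_0 + alpha_1 + alpha_4], [n_2 = - alpha_1 + alpha_2],
   [n_3 = - alpha_2 + alpha_3 - alpha_4], [n_4 = - alpha_3 - alpha_4]
   and [alpha_0 + ... + alpha_4 = 1]. *)
Definition alpha4 (nv : nat -> int) : int :=
  (- ((1 + nv 1%N + 2 * nv 2%N + 3 * nv 3%N + 4 * nv 4%N)%R %/ 5)%Z)%R.

(* [n'_(rot5 i) - n_i], where [n'] is the n-vector obtained from that of [n] by
   the rotation [alpha'_(i+1) = alpha_i]. *)
Definition runner_shift (nv : nat -> int) (i : nat) : int :=
  (let a := alpha4 nv in
   nth 0 [:: nv 2%N + nv 4%N + a - nv 0%N; nv 3%N + 2 * nv 4%N + 3 * a - nv 1%N;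
             nv 0%N - nv 4%N - nv 2%N - 3 * a; nv 1%N - nv 3%N - a; - 2 * nv 4%N] i)%R.

(* Makes every shift nonnegative; even, so that parities are not affected. *)
Definition shift_pad (nv : nat -> int) : nat :=
  2 * \sum_(i <- iota 0 5) `|runner_shift nv i|%N.

Definition nat_shift (nv : nat -> int) (i : nat) : nat :=
  `|(runner_shift nv i + Posz (shift_pad nv))%R|%N.

(** The number of rows bounds the number of parts, is a multiple of 5 for the residue classes and is
    even for the srank formula. *)
Definition rotate (s : seq nat) : seq nat :=
  of_beads (transport (nat_shift (nvec 5 s)) (beads (10 * sumn s) s)).

Lemma nat_shiftE nv i : i < 5 ->
  Posz (nat_shift nv i) = (runner_shift nv i + Posz (shift_pad nv))%R.
Proof.
move=> i5; rewrite /nat_shift /shift_pad sum_iota5.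
by case: i i5 => [|[|[|[|[|i]]]]] // _; lia.
Qed.

Lemma sum_nvec5 s :
  (nvec 5 s 0%N + nvec 5 s 1%N + nvec 5 s 2%N + nvec 5 s 3%N + nvec 5 s 4%N = 0)%R.
Proof. by rewrite /nvec modnn !modn_small //; lia. Qed.

Lemma size_partition s : is_partition s -> size s <= sumn s.
Proof.
case/andP=> _; elim: s => [//|x s IH] /= /andP[x0 /IH]; lia.
Qed.

(* In the coordinates [alpha_i] the quadratic part of the size is invariant
   under cyclic rotation. *)
Lemma energy_balance (n0 n1 n2 n3 n4 a m c c0 c1 c2 c3 c4 d0 d1 d2 d3 d4 S S' w : int) :
  (n0 + n1 + n2 + n3 + n4 = 0 ->
  - (5 * a) = 1 + n1 + 2 * n2 + 3 * n3 + 4 * n4 ->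
  c0 = n0 + 2 * m -> c1 = n1 + 2 * m -> c2 = n2 + 2 * m -> c3 = n3 + 2 * m ->
  c4 = n4 + 2 * m ->
  d0 = n2 + n4 + a - n0 + c -> d1 = n3 + 2 * n4 + 3 * a - n1 + c ->
  d2 = n0 - n4 - n2 - 3 * a + c -> d3 = n1 - n3 - a + c -> d4 = - 2 * n4 + c ->
  2 * S + 10 * m = 2 * m + 100 * (m * m) ->
  2 * S' + (10 * m + 5 * c) = 2 * w + (10 * m + 5 * c) * (10 * m + 5 * c) ->
  2 * S' + 5 * d0 + 2 * c1 + 5 * d1 + 4 * c2 + 5 * d2 + 6 * c3 + 5 * d3 + 8 * c4 + 5 * d4 =
  2 * S + 2 * (c0 * (5 * d0 + 3)) + 5 * (d0 * d0) + 6 * d0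
        + 2 * (c1 * (5 * d1 + 4)) + 5 * (d1 * d1) + 8 * d1
        + 2 * (c2 * (5 * d2 + 1)) + 5 * (d2 * d2) + 2 * d2
        + 2 * (c3 * (5 * d3 + 2)) + 5 * (d3 * d3) + 4 * d3
        + 2 * (c4 * (5 * d4)) + 5 * (d4 * d4) ->
  w = m)%R.
Proof.
(* Pass to the alpha coordinates, [a] being [alpha_4]: the formulas for [n0], [n4], [n1], [n2]
   define [a0], [a3], [a1], [a2]; the zero sum then gives [e3], and the weight gives [ea]. *)
move=> z wt; have [a0 e0] : {a0 | n0 = a0 + a}%R by exists (n0 - a)%R; lia.
have [a3 e4] : {a3 | n4 = - a3 - a}%R by exists (- n4 - a)%R; lia.
have [a1 e1] : {a1 | n1 = - a0 + a1 + a}%R by exists (n1 + a0 - a)%R; lia.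
have [a2 e2] : {a2 | n2 = - a1 + a2}%R by exists (n2 + a1)%R; lia.
have e3 : (n3 = - a2 + a3 - a)%R by lia.
have ea : (a = 1 - a0 - a1 - a2 - a3)%R by lia.
subst n0 n1 n2 n3 n4; subst a; clear z wt.
do 10 move=> ->; move=> h1 h2 h3; lia.
Qed.

(** * Effect of the rotation on a partition of [5n+4] *)

Section Rotate.
Variables (n : nat) (s : seq nat).
Hypotheses (ps : is_partition s) (sumS : sumn s = 5 * n + 4).
Let m := 5 * n + 4.
Let B := beads (10 * m) s.
Let nv := nvec 5 s.
Let D := nat_shift nv.
Let C := shift_pad nv.
Let B' := transport D B.

Let sM : size s <= 10 * m.
Proof. by apply: leq_trans (size_partition ps) _; rewrite sumS leq_pmull. Qed.

Let class_countE i : i < 5 -> (nv i + Posz (2 * m))%R = Posz (class_count B i).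
Proof.
have e : 10 * m = 2 * m * 5 by lia.
by move=> i5; rewrite /class_count /B e -nvec_beads // -e.
Qed.

(** The division in [alpha4] is exact: modulo 5 the beads sum to the size, which is 4, and also to
    the weighted sum of the [n_i]. *)
Lemma nvec_weight :
  (- (5 * alpha4 (nvec 5 s)) =
   1 + nvec 5 s 1%N + 2 * nvec 5 s 2%N + 3 * nvec 5 s 3%N + 4 * nvec 5 s 4%N)%R.
Proof.
have hs : \sum_(b <- B) b + 5 * m = m + 5 * (10 * (m * m)).
  by have := sum_beads sM; rewrite sumS -/m -/B; nia.
have hB : \sum_(b <- B) b = 5 * (\sum_(b <- B) b %/ 5)
    + \sum_(i <- iota 0 5) class_count B i * i.
  rewrite -(sum_by_class id) big_distrr /= -big_split /=; apply: eq_bigr => b _.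
  by rewrite {1}(divn_eq b 5) mulnC.
move: hB; rewrite sum_iota5 /alpha4 -/nv.
have := class_countE (isT : 0 < 5); have := class_countE (isT : 1 < 5).
have := class_countE (isT : 2 < 5); have := class_countE (isT : 3 < 5).
have := class_countE (isT : 4 < 5).
have hm : m = 5 * n + 4 by [].
by move: hs; set mm := m * m; move: mm hm => mm; clearbody m; lia.
Qed.

Let D_sum : \sum_(i <- iota 0 5) D i = 5 * C.
Proof.
rewrite sum_iota5.
have := nat_shiftE nv (isT : 0 < 5); have := nat_shiftE nv (isT : 1 < 5).
have := nat_shiftE nv (isT : 2 < 5); have := nat_shiftE nv (isT : 3 < 5).
have := nat_shiftE nv (isT : 4 < 5); rewrite -/D -/C /runner_shift /=.
have := sum_nvec5 s; rewrite -/nv; lia.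
Qed.

Let C_even : C = C./2.*2.
Proof. by rewrite /C /shift_pad mul2n doubleK. Qed.

(** Modulo 2, [nvec_weight] says that [alpha_4] is [1 + n_1 + n_3]; with the zero sum of the [n_i]
    this makes the shifts odd for [i < 4], while the last is even. *)
Let D_parity i : i < 5 -> odd (D i) = odd (rot5 i + i).
Proof.
move=> i5; have := nat_shiftE nv i5; have := sum_nvec5 s; have := nvec_weight; have := C_even.
rewrite -/D -/C -/nv /runner_shift; set a := alpha4 nv.
by case: i i5 => [|[|[|[|[|i]]]]] //= _; lia.
Qed.

Let sizeB' : size B' = 10 * m + 5 * C.
Proof. by rewrite size_transport size_beads D_sum. Qed.

Let uB' : uniq B'.
Proof. exact: transport_uniq (uniq_beads _ ps). Qed.

Let rotateE : rotate s = of_beads B'.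
Proof. by rewrite /rotate sumS. Qed.

Lemma rotate_is_partition : is_partition (rotate s).
Proof. by rewrite rotateE; exact: of_beads_is_partition. Qed.

Let size_rotate : size (rotate s) <= 10 * m + 5 * C.
Proof. by rewrite rotateE -sizeB'; exact: size_of_beads. Qed.

Lemma beads_rotate :
  perm_eq (beads (10 * (5 * n + 4) + 5 * shift_pad (nvec 5 s)) (rotate s))
    (transport (nat_shift (nvec 5 s)) (beads (10 * (5 * n + 4)) s)).
Proof. by rewrite rotateE -sizeB'; exact: of_beadsK. Qed.

(** The pad adds [C] beads to every class, matched by the [5 * C] extra rows in the normalization of
    [nvec_beads]. *)
Lemma nvec_rotate i : i < 5 ->
  (nvec 5 (rotate s) (rot5 i) = nvec 5 s i + runner_shift (nvec 5 s) i)%R.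
Proof.
move=> i5; have eM : 10 * m + 5 * C = (2 * m + C) * 5 by lia.
have := @nvec_beads 5 (2 * m + C) (rotate s) _ (rot5_lt i).
rewrite -eM => /(_ size_rotate); rewrite (permP beads_rotate) -/(class_count _ _).
rewrite class_count_transport //; have := class_countE i5; have := nat_shiftE nv i5.
by rewrite -/m -/B -/nv -/D -/C; lia.
Qed.

Lemma sumn_rotate : sumn (rotate s) = 5 * n + 4.
Proof.
have hB' := sum_beads size_rotate; rewrite (perm_big _ beads_rotate) /= in hB'.
have hB := sum_beads sM; rewrite sumS -/m -/B in hB.
have hT := sum_transport D B; rewrite !sum_iota5 /rot5 /= in hT.
rewrite !(mul0n, muln0, muln1, addn0, add0n) -/B' in hT.
suff : Posz (sumn (rotate s)) = Posz m by lia.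
have := D_sum; have := sum_nvec5 s; have := nvec_weight; rewrite -/nv sum_iota5.
have := nat_shiftE nv (isT : 0 < 5); have := nat_shiftE nv (isT : 1 < 5).
have := nat_shiftE nv (isT : 2 < 5); have := nat_shiftE nv (isT : 3 < 5).
have := nat_shiftE nv (isT : 4 < 5).
have := class_countE (isT : 0 < 5); have := class_countE (isT : 1 < 5).
have := class_countE (isT : 2 < 5); have := class_countE (isT : 3 < 5).
have := class_countE (isT : 4 < 5).
move: hB' hB hT; rewrite -/D -/C /runner_shift /=.
move: (nv 0) (nv 1) (nv 2) (nv 3) (nv 4) (alpha4 nv) => n0 n1 n2 n3 n4 a.
move: (D 0) (D 1) (D 2) (D 3) (D 4) => d0 d1 d2 d3 d4.
move: (class_count B 0) (class_count B 1) (class_count B 2) (class_count B 3)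
  (class_count B 4) => c0 c1 c2 c3 c4.
move: (\sum_(b <- B) b) (\sum_(b <- B') b) (sumn _) => S S' w h1 h2 h3.
move=> e4 e3 e2 e1 e0 f3 f2 f1 f0 f4 wt z _.
apply: (@energy_balance n0 n1 n2 n3 n4 a m C c0 c1 c2 c3 c4 d0 d1 d2 d3 d4 S S' w) => //; lia.
Qed.

(** The number of even beads grows by [5 * C./2], as does the half-length [h] of [srank_beads],
    while the size is unchanged. *)
Lemma srank_rotate : (srank (rotate s) = srank s %[mod 4])%Z.
Proof.
have eM : 10 * m = (5 * m).*2 by lia.
have eM' : 10 * m + 5 * C = (5 * m + 5 * C./2).*2 by have := C_even; lia.
have := @srank_beads s (5 * m) ps; rewrite -eM => /(_ sM).
have := @srank_beads (rotate s) (5 * m + 5 * C./2) rotate_is_partition.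
rewrite -eM' => /(_ size_rotate); rewrite (permP beads_rotate) sumn_rotate sumS.
have := even_count_transport B D_parity; rewrite D_sum -/B'.
have := C_even; rewrite -/B; move: (count _ B) (count _ B') => e e'.
move: (srank s) (srank _) (C) (5 * n + 4) => r r' c k; move: (5 * m) => l.
by clear; move: (c./2) => h; lia.
Qed.

Lemma crank5_rotate : (crank5 (rotate s) = crank5 s + 1 %[mod 5])%Z.
Proof.
rewrite /crank5.
(* The crank uses the entries 0, 1, 2, 3, which are the images under [rot5] of 4, 2, 3, 0. *)
have := nvec_rotate (isT : 0 < 5); have := nvec_rotate (isT : 3 < 5).
have := nvec_rotate (isT : 2 < 5); have := nvec_rotate (isT : 4 < 5).
rewrite /runner_shift /rot5 /= -/nv => -> -> -> ->.
have := sum_nvec5 s; have := nvec_weight; rewrite -/nv; lia.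
Qed.

End Rotate.

(** The induced map on n-vectors is injective, so equal images come from equal displacements, and
    [transport] with fixed displacements can be undone. *)
Lemma rotate_inj n s s' : is_partition s -> is_partition s' ->
  sumn s = 5 * n + 4 -> sumn s' = 5 * n + 4 -> rotate s = rotate s' -> s = s'.
Proof.
move=> ps ps' es es' er.
have env : [/\ nvec 5 s 0 = nvec 5 s' 0, nvec 5 s 1 = nvec 5 s' 1,
    nvec 5 s 2 = nvec 5 s' 2, nvec 5 s 3 = nvec 5 s' 3 & nvec 5 s 4 = nvec 5 s' 4].
  have := sum_nvec5 s; have := sum_nvec5 s'.
  have := nvec_weight ps es; have := nvec_weight ps' es'.
  have eq i (i5 : i < 5) := etrans (esym (nvec_rotate ps es i5))
    (etrans (congr1 (fun u => nvec 5 u (rot5 i)) er) (nvec_rotate ps' es' i5)).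
  have := eq 0 isT; have := eq 1 isT; have := eq 2 isT; have := eq 3 isT; have := eq 4 isT.
  by rewrite /runner_shift /=; split; lia.
have eD : runner_shift (nvec 5 s) = runner_shift (nvec 5 s').
  by rewrite /runner_shift /alpha4; case: env => -> -> -> -> ->.
have := beads_rotate ps' es'; rewrite -er.
have eC : shift_pad (nvec 5 s) = shift_pad (nvec 5 s') by rewrite /shift_pad eD.
have eN : nat_shift (nvec 5 s) = nat_shift (nvec 5 s') by rewrite /nat_shift eD eC.
rewrite -eC -eN perm_sym => pe.
have {}pe := transport_inj (perm_trans pe (beads_rotate ps es)).
have le u : is_partition u -> sumn u = 5 * n + 4 -> size u <= 10 * (5 * n + 4).
  by move=> pu eu; apply: leq_trans (size_partition pu) _; rewrite eu leq_pmull.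
by apply/esym; apply: beads_inj pe => //; exact: le.
Qed.

(** * Counting with the tuple encoding *)

Lemma nth_leq_sumn s k : nth 0 s k <= sumn s.
Proof.
elim: s k => [|x s IH] [|k] //=; first exact: leq_addr.
exact: leq_trans (IH k) (leq_addl _ _).
Qed.

Definition ptuple_of (m : nat) (s : seq nat) : ptuple m :=
  [tuple inord (nth 0 s k) | k < m].

Lemma ptuple_ofE m s : is_partition s -> sumn s = m ->
  map val (ptuple_of m s) = mkseq (nth 0 s) m.
Proof.
move=> ps es; apply: (@eq_from_nth _ 0) => [|k]; rewrite size_map size_tuple ?size_mkseq // => km.
rewrite (nth_map ord0) ?size_tuple // nth_mkseq // -[k]/(val (Ordinal km)) -tnth_nth tnth_mktuple.
rewrite /= inordK // ltnS -es.
exact: nth_leq_sumn.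
Qed.

Lemma valid_partition m (t : ptuple m) : valid t ->
  is_partition (parts_of t) /\ sumn (parts_of t) = m.
Proof.
case/andP=> st /eqP et; split; first exact: filter_pos_is_partition.
by rewrite -[RHS]et /parts_of; elim: (map val t) => //= x s <-; case: x.
Qed.

Lemma parts_of_inj m : {in @valid m &, injective (@parts_of m)}.
Proof.
move=> t t' /andP[st _] /andP[st' _] e; apply/val_inj/(inj_map val_inj).
apply: (@eq_from_nth _ 0) => [|r _]; first by rewrite !size_map !size_tuple.
by rewrite -nth_filter_pos // -[RHS]nth_filter_pos //; congr nth.
Qed.

Lemma valid_ptuple_of m s : is_partition s -> sumn s = m ->
  valid (ptuple_of m s) /\ parts_of (ptuple_of m s) = s.
Proof.
move=> ps es; have sm : size s <= m by rewrite -es; exact: size_partition.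
have st : sorted geq (mkseq (nth 0 s) m).
  apply/(sortedP 0) => k; rewrite size_mkseq => km.
  by rewrite !nth_mkseq //= ?(is_partition_nth ps) //; lia.
rewrite /valid /parts_of ptuple_ofE // st; split.
  rewrite (sumn_nth (leqnn _)) size_mkseq -[X in _ == X]es (sumn_nth sm); apply/eqP.
  by apply: eq_big_nat => k /andP[_ km]; rewrite nth_mkseq.
apply: partition_eq_nth => // [|r]; first exact: filter_pos_is_partition.
rewrite nth_filter_pos //; have [rm|mr] := ltnP r m; first by rewrite nth_mkseq.
by rewrite !nth_default ?size_mkseq //; exact: leq_trans mr.
Qed.

Definition crank_class (i m : nat) (j : 'I_5) : {set ptuple m} :=
  [set t | valid t && srank_cong (parts_of t) i
           && (crank5 (parts_of t) == Posz j %[mod 5])%Z].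

Lemma p_srank_c5E i m (j : 'I_5) : p_srank_c5 i j m = #|crank_class i m j|.
Proof.
apply: eq_card => t; rewrite !inE -andbA; case vt: (valid t) => //=.
have [pt _] := valid_partition vt.
apply/asboolP/andP => [[h1 /(c5_congE _ pt) h2]|[h1 /eqP h2]]; first by split=> //; exact/eqP.
by split=> //; apply/c5_congE.
Qed.

Lemma p_srankE i m : p_srank i m = \sum_(j < 5) #|crank_class i m j|.
Proof.
pose cl (t : ptuple m) : 'I_5 := inord `|(crank5 (parts_of t) %% 5)%Z|%N.
rewrite /p_srank -sum1_card (partition_big cl predT) //=; apply: eq_bigr => j _.
rewrite -sum1_card; apply: eq_bigl => t; rewrite !inE; congr (_ && _).
apply/eqP/eqP => [<-|h].
  rewrite /cl inordK; last by lia.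
  by lia.
apply/val_inj; rewrite /cl h /=; have := ltn_ord j => lj.
by rewrite inordK; lia.
Qed.

Lemma leq_crank_class n i (j : 'I_5) :
  #|crank_class i (5 * n + 4) j| <= #|crank_class i (5 * n + 4) (ordS j)|.
Proof.
set m := 5 * n + 4; pose f (t : ptuple m) := ptuple_of m (rotate (parts_of t)).
have fP t : valid t -> valid (f t) /\ parts_of (f t) = rotate (parts_of t).
  move=> vt; have [pt et] := valid_partition vt.
  by apply: valid_ptuple_of; [exact: rotate_is_partition et | exact: sumn_rotate].
have finj : {in crank_class i m j &, injective f}.
  move=> t t'; rewrite !inE => /andP[/andP[vt _] _] /andP[/andP[vt' _] _] e.
  have [pt et] := valid_partition vt; have [pt' et'] := valid_partition vt'.
  apply: parts_of_inj => //; apply: (rotate_inj pt pt' et et').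
  by rewrite -(fP t vt).2 -(fP t' vt').2 e.
rewrite -(card_in_imset finj); apply/subset_leq_card/subsetP => _ /imsetP[t + ->].
rewrite !inE => /andP[/andP[vt /eqP st] /eqP ct].
have [pt et] := valid_partition vt; have [vf ef] := fP t vt.
rewrite vf ef /= /srank_cong (srank_rotate pt et) st eqxx /=; apply/eqP.
have := crank5_rotate pt et; move: ct; rewrite /= -modz_nat.
by lia.
Qed.

Theorem theorem3 (n i j : nat) :
  (i == 0) || (i == 2) -> j < 5 ->
  5 * p_srank_c5 i j (5 * n + 4) = p_srank i (5 * n + 4).
Proof.
move=> _ j5; rewrite p_srankE (p_srank_c5E i _ (Ordinal j5)).
pose c k := #|crank_class i (5 * n + 4) (inord k)|.
have cE (k : 'I_5) : #|crank_class i (5 * n + 4) k| = c k by rewrite /c inord_val.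
have step k : k < 5 -> c k <= c (k.+1 %% 5).
  move=> k5; have := leq_crank_class n i (Ordinal k5).
  by rewrite !cE.
under eq_bigr => k _ do rewrite cE.
rewrite cE /= !big_ord_recl big_ord0 /= /bump /= !add1n.
(* Five inequalities around a cycle force all class sizes to be equal. *)
have := step 0 isT; have := step 1 isT; have := step 2 isT.
have := step 3 isT; have := step 4 isT; rewrite modnn !modn_small //.
by case: j j5 => [|[|[|[|[|j]]]]] // _; lia.
Qed.
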